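(* The following statements are equivalent: (a) $\hat\beta_{AL}$ is pointwise consistent for $\beta$, i.e. for every $\beta\in\mathbb{R}^p$ and every $\epsilon>0$, $P_\beta(\|\hat\beta_{AL}-\beta\|>\epsilon)\to0$; (b) $\hat\beta_{AL}$ is uniformly consistent for $\beta$, i.e. for every $\epsilon>0$, $\sup_{\beta\in\mathbb{R}^p}P_\beta(\|\hat\beta_{AL}-\beta\|>\epsilon)\to0$; (c) $\lambda^*/n\to0$ as $n\to\infty$; (d) for every $\beta\in\mathbb{R}^p$ and every $j\in\mathcal{A}(\beta)$, $P_\beta(\hat\beta_{AL,j}=0)\to0$ as $n\to\infty$.
   Context: For each $n\ge p$: linear regression model $y=X\beta+\varepsilon$ with $y\in\mathbb{R}^n$, non-stochastic $X\in\mathbb{R}^{n\times p}$ ($p$ fixed) of full column rank, unknown $\beta\in\mathbb{R}^p$, and $\varepsilon$ with i.i.d. components of mean zero and finite variance $\sigma^2>0$; $P_\beta$ is the probability when the true parameter is $\beta$. $X'X/n\to C$ positive definite as $n\to\infty$. $\hat\beta_{LS}=(X'X)^{-1}X'y$; the events $\{\hat\beta_{LS,j}=0\}$ have probability zero and are excluded. Non-negative tuning parameters $\lambda_j=\lambda_{n,j}$, $\lambda^*=\max_j\lambda_j$. Adaptive Lasso: $\hat\beta_{AL}=\arg\min_{b\in\mathbb{R}^p}\big(\|y-Xb\|^2+2\sum_{j=1}^p\lambda_j|b_j|/|\hat\beta_{LS,j}|\big)$. The active set is $\mathcal{A}=\mathcal{A}(\beta)=\{j:\beta_j\neq0\}$.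 *)

(* Defs.v *)
From HB Require Import structures.
From mathcomp Require Import all_boot all_order all_algebra.
From mathcomp Require Import all_classical all_reals all_analysis.
Set Implicit Arguments. Unset Strict Implicit. Unset Printing Implicit Defensive.
Import Order.TTheory GRing.Theory Num.Theory.
Local Open Scope classical_set_scope.
Local Open Scope ring_scope.

Section AdaptiveLasso.
Variables (R : realType) (n p : nat).

Definition enorm (v : 'cV[R]_p) : R := Num.sqrt (\sum_(j < p) (v j 0) ^+ 2).

Definition sqnorm (v : 'cV[R]_n) : R := \sum_(i < n) (v i 0) ^+ 2.

Definition betaLS (X : 'M[R]_(n, p)) (y : 'cV[R]_n) : 'cV[R]_p :=
  invmx (X^T *m X) *m X^T *m y.

Definition AL_obj (X : 'M[R]_(n, p)) (lam : 'I_p -> R) (y : 'cV[R]_n)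
  (b : 'cV[R]_p) : R :=
  sqnorm (y - X *m b)
  + 2 * \sum_(j < p) lam j * `|b j 0| / `|betaLS X y j 0|.

(* the adaptive Lasso estimator: the (unique) minimizer of AL_obj *)
Definition betaAL (X : 'M[R]_(n, p)) (lam : 'I_p -> R) (y : 'cV[R]_n)
  : 'cV[R]_p :=
  xget 0 [set b | forall b', AL_obj X lam y b <= AL_obj X lam y b'].

End AdaptiveLasso.

(* lambda^* = max_j lambda_j (tuning parameters are nonnegative) *)
Definition lam_star (R : realType) (p : nat) (lam : 'I_p -> R) : R :=
  \big[Num.max/0]_(j < p) lam j.

Definition resp (R : realType) (T : Type) (n p : nat) (X : 'M[R]_(n, p))
  (beta : 'cV[R]_p) (eps : nat -> T -> R) (w : T) : 'cV[R]_n :=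
  X *m beta + \col_(i < n) eps (nat_of_ord i) w.

(* Main.v *)
(* Write mu = lambda^*/n and G_n = X'X/n -> C. Comparing the objective at the
   minimizer with its value at the least squares estimator LS gives the
   deterministic bound ||X (AL - LS)||^2 <= 2 sum_j lambda_j, and G_n is
   eventually bounded below, so ||AL - LS||^2 = O(mu); since E ||LS - beta||^2
   is O(1/n) uniformly in beta, (c) implies (b). (b) => (a) and (a) => (d) are
   immediate. For (d) => (c): if lambda_j/n does not tend to 0, take
   beta = t e_j; LS is then of order t, so the penalty slope lambda_j/|LS_j| is
   at least of order n/t along a subsequence and beats the gradient of the
   residual sum of squares, which is of order n t. For small t this forces
   AL_j = 0 with probability close to 1.

   P is unspecified on non-measurable sets, so the events must be shown to be
   measurable; this holds for n large, when the minimizer exists and is unique. *)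
Require Import Defs.
From HB Require Import structures.
From mathcomp Require Import all_boot all_order all_algebra.
From mathcomp Require Import all_classical all_reals all_analysis.
From mathcomp Require Import measurable_realfun ring lra.
Set Implicit Arguments. Unset Strict Implicit. Unset Printing Implicit Defensive.
Import Order.TTheory GRing.Theory Num.Theory numFieldNormedType.Exports.
Local Open Scope classical_set_scope.
Local Open Scope ring_scope.

(** * Quadratic forms and the Gram matrix *)

Lemma sqnorm_ge0 (R : realType) n (v : 'cV[R]_n) : 0 <= sqnorm v.
Proof. by apply: sumr_ge0 => i _; exact: sqr_ge0. Qed.

Lemma sqnorm0 (R : realType) n : sqnorm (0 : 'cV[R]_n) = 0.
Proof. by apply: big1 => i _; rewrite mxE expr0n. Qed.

Lemma sqnormN (R : realType) n (v : 'cV[R]_n) : sqnorm (- v) = sqnorm v.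
Proof. by apply: eq_bigr => i _; rewrite mxE sqrrN. Qed.

Lemma sqnormE (R : realType) n (v : 'cV[R]_n) : sqnorm v = (v^T *m v) 0 0.
Proof. by rewrite mxE; apply: eq_bigr => i _; rewrite !mxE expr2. Qed.

Lemma sqnormD (R : realType) n (u v : 'cV[R]_n) :
  sqnorm (u + v) = sqnorm u + 2 * (u^T *m v) 0 0 + sqnorm v.
Proof.
rewrite mxE mulr_sumr -!big_split; apply: eq_bigr => i _.
by rewrite !mxE /=; ring.
Qed.

Lemma coord_sqnorm (R : realType) n (v : 'cV[R]_n) i : v i 0 ^+ 2 <= sqnorm v.
Proof.
by rewrite /sqnorm (bigD1 i)//= lerDl; apply: sumr_ge0 => j _; exact: sqr_ge0.
Qed.

Lemma coord_sqnorm_le (R : realType) n (v : 'cV[R]_n) i (s : R) :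
  0 <= s -> sqnorm v <= s ^+ 2 -> `|v i 0| <= s.
Proof.
move=> s0 vs; rewrite -ler_sqr ?nnegrE// real_normK ?num_real//.
exact: le_trans (coord_sqnorm _ _) vs.
Qed.

Lemma gram_formE (R : realType) n p (X : 'M[R]_(n, p)) (v : 'cV[R]_p) :
  (v^T *m (X^T *m X) *m v) 0 0 = sqnorm (X *m v).
Proof. by rewrite sqnormE trmx_mul !mulmxA. Qed.

(** A nonzero row in the left kernel of [C] would make the quadratic form vanish. *)
Lemma posdef_unitmx (R : realType) p (C : 'M[R]_p) :
  (forall v : 'cV[R]_p, v != 0 -> 0 < (v^T *m C *m v) 0 0) -> C \in unitmx.
Proof.
move=> Cpos; rewrite -row_free_unit -kermx_eq0; apply/negP => /negP/rowV0Pn[v].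
move=> /sub_kermxP vC v0; have := Cpos v^T.
by rewrite trmx_eq0 trmxK vC mul0mx mxE ltxx => /(_ v0).
Qed.

(* Cauchy-Schwarz for the form C against u = C^-1 e_j gives
   v_j^2 <= (C^-1)_jj v'Cv; sum over j. *)
Lemma posdef_coercive (R : realType) p (C : 'M[R]_p) : C^T = C ->
  (forall v : 'cV[R]_p, v != 0 -> 0 < (v^T *m C *m v) 0 0) ->
  exists2 c : R, 0 < c & forall v, c * sqnorm v <= (v^T *m C *m v) 0 0.
Proof.
move=> CT Cpos; have Cu := posdef_unitmx Cpos.
pose u j := col j (invmx C).
have Cuj j : C *m u j = delta_mx j 0.
  by rewrite /u colE mulmxA mulmxV// mul1mx.
have uC j (v : 'cV[R]_p) : ((u j)^T *m C *m v) 0 0 = v j 0.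
  rewrite -[in X in _ *m X *m _]CT -trmx_mul Cuj trmx_delta -rowE mxE.
  by [].
pose a j := u j j 0.
have a0 j : 0 < a j.
  rewrite /a -(uC j (u j)); apply: Cpos; apply/eqP => uj0.
  have := Cuj j; rewrite uj0 mulmx0 => /matrixP/(_ j 0)/eqP.
  by rewrite !mxE !eqxx eq_sym oner_eq0.
have CS j (v : 'cV[R]_p) : v j 0 ^+ 2 <= a j * (v^T *m C *m v) 0 0.
  (* This [t] minimizes the form at [v - t *: u j]; nonnegativity of the minimum is the
     Cauchy-Schwarz inequality. *)
  pose t := v j 0 / a j.
  have : 0 <= ((v - t *: u j)^T *m C *m (v - t *: u j)) 0 0.
    have [->|/Cpos/ltW//] := eqVneq (v - t *: u j) 0.
    by rewrite mulmx0 mxE.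
  have vCu : (v^T *m C *m u j) 0 0 = v j 0.
    by rewrite -mulmxA Cuj -colE !mxE.
  have -> : (v - t *: u j)^T = v^T - t *: (u j)^T.
    by apply/matrixP => i k; rewrite !mxE.
  rewrite mulmxBr !mulmxBl -!scalemxAl -!scalemxAr.
  move: vCu (uC j v) (uC j (u j)) (a0 j); rewrite -/(a j).
  move: (v^T *m C *m u j) ((u j)^T *m C *m v) ((u j)^T *m C *m u j) => q1 q2 q3.
  move: (v^T *m C *m v) => q E1 E2 E3 aj; rewrite !mxE E1 E2 E3 /t.
  set x := v j 0; set y := q 0 0.
  have -> : y - x / a j * x - (x / a j * x - x / a j * (x / a j * a j)) =
      y - x ^+ 2 / a j.
    by field; rewrite gt_eqF.
  by rewrite subr_ge0 ler_pdivrMr// mulrC.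
(* The summand 1 keeps the constant positive when [p] is 0. *)
exists (1 + \sum_j a j)^-1.
  by rewrite invr_gt0 ltr_pwDl// sumr_ge0// => j _; exact: ltW.
have q0 (v : 'cV[R]_p) : 0 <= (v^T *m C *m v) 0 0.
  have [->|/Cpos/ltW//] := eqVneq v 0.
  by rewrite mulmx0 mxE.
move=> v; rewrite ler_pdivrMl; last first.
  by rewrite ltr_pwDl// sumr_ge0// => j _; exact: ltW.
rewrite mulrDl mul1r ler_wpDl// mulr_suml.
by apply: ler_sum => j _; exact: CS.
Qed.

(** Each product satisfies |v_i v_j| <= (v_i^2 + v_j^2) / 2, and summing over both indices produces
    the factor [p]. *)
Lemma form_bound (R : realType) p (E : 'M[R]_p) (eta : R) (v : 'cV[R]_p) :
  (forall i j, `|E i j| <= eta) ->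
  `|(v^T *m E *m v) 0 0| <= eta * p%:R * sqnorm v.
Proof.
move=> Ebd.
have -> : eta * p%:R * sqnorm v =
    \sum_(j < p) \sum_(i < p) eta * ((v i 0 ^+ 2 + v j 0 ^+ 2) / 2).
  under eq_bigr do rewrite -mulr_sumr -mulr_suml big_split/= sumr_const card_ord.
  rewrite -mulr_sumr -mulr_suml big_split/= sumr_const card_ord !sumrMnl.
  by rewrite -/(sqnorm v) -(mulr_natr (sqnorm v)); field.
rewrite mxE (le_trans (ler_norm_sum _ _ _))//; apply: ler_sum => j _.
rewrite mxE mulr_suml (le_trans (ler_norm_sum _ _ _))//; apply: ler_sum => i _.
rewrite !mxE !normrM mulrAC [_ * `|E _ _|]mulrC ler_pM//.
rewrite -(real_normK (num_real (v i 0))) -(real_normK (num_real (v j 0))).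
have := sqr_ge0 (`|v i 0| - `|v j 0|); rewrite sqrrB; lra.
Qed.

(** Entrywise closeness of X'X/n to [C] perturbs the form by a small multiple of [sqnorm v], so half
    of the coercivity constant of [C] survives. All later estimates use the design only through [c]
    and [K]. *)
Lemma gram_eventually (R : realType) p (X : forall n : nat, 'M[R]_(n, p))
    (C : 'M[R]_p) :
  (forall i j,
    (fun n : nat => (n%:R^-1 *: ((X n)^T *m X n)) i j) @ \oo --> (C i j : R)) ->
  C^T = C ->
  (forall v : 'cV[R]_p, v != 0 -> 0 < (v^T *m C *m v) 0 0) ->
  exists c K : R, [/\ 0 < c, 0 < K & \forall n \near \oo, [/\ (0 < n)%N,
    forall v, n%:R * c * sqnorm v <= sqnorm (X n *m v) &
    forall i j, `|((X n)^T *m X n) i j| <= n%:R * K]].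
Proof.
move=> GC CT Cpos; have [c c0 Cc] := posdef_coercive CT Cpos.
(* Chosen so that [eta * p%:R] is at most [c / 2]; the successor avoids a division by zero when [p]
   is 0. *)
pose eta := c / (2 * p.+1%:R).
have eta0 : 0 < eta by rewrite divr_gt0// mulr_gt0.
have Gn : \forall n \near \oo, forall i j,
    `|C i j - (n%:R^-1 *: ((X n)^T *m X n)) i j| < eta.
  apply: filter_forall => i; apply: filter_forall => j.
  by move/cvgrPdist_lt : (GC i j) => /(_ _ eta0).
exists (c / 2), (\sum_i \sum_j `|C i j| + eta).
split.
- by rewrite divr_gt0.
- by rewrite ltr_wpDl// sumr_ge0// => i _; rewrite sumr_ge0.
- near=> n.
  have n0 : (0 < n)%N by near: n; exact: nbhs_infty_gt.
  have nR : 0 < n%:R :> R by rewrite ltr0n.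
  have Gnn : forall i j,
    `|C i j - (n%:R^-1 *: ((X n)^T *m X n)) i j| < eta by near: n.
  split => //.
  + move=> v.
    set G := n%:R^-1 *: ((X n)^T *m X n) in Gnn.
    have -> : sqnorm (X n *m v) = n%:R * (v^T *m G *m v) 0 0.
      rewrite /G -scalemxAr -scalemxAl -gram_formE.
      move: (v^T *m _ *m v) => q; rewrite mxE mulrA mulfV ?mul1r//.
      by rewrite gt_eqF.
    rewrite -mulrA ler_pM2l//.
    have : `|(v^T *m (C - G) *m v) 0 0| <= eta * p%:R * sqnorm v.
      by apply: form_bound => i j; rewrite !mxE; move: (Gnn i j) => /ltW; rewrite !mxE.
    rewrite mulmxBr mulmxBl => /ler_normlP[_]; rewrite mxE [X in _ + X]mxE.
    have : eta * p%:R * sqnorm v <= c / 2 * sqnorm v.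
      rewrite ler_wpM2r ?sqnorm_ge0//.
      have -> : eta = c / 2 / p.+1%:R.
        by rewrite /eta invfM mulrA.
      rewrite -mulrA ler_piMr ?divr_ge0 ?ltW//.
      by rewrite mulrC ltr_pdivrMr// mul1r ltr_nat.
    have := Cc v; lra.
  + move=> i j; have := Gnn i j; rewrite mxE distrC => /ltW Gij.
    set a := (_ *m _) i j in Gij *.
    have -> : a = n%:R * (n%:R^-1 * a) by rewrite mulrA mulfV ?mul1r// gt_eqF.
    rewrite normrM (gtr0_norm nR) ler_pM2l//.
    rewrite -[X in `|X|](subrK (C i j)) (le_trans (ler_normD _ _))// addrC lerD//.
    rewrite (bigD1 i)//= (bigD1 j)//= -addrA lerDl addr_ge0// sumr_ge0// => k _.
    by rewrite sumr_ge0.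
Unshelve. all: by end_near.
Qed.

(** * The adaptive Lasso minimizer *)

Lemma sqnormB_le (R : realType) n (u v : 'cV[R]_n) :
  sqnorm (u - v) <= 2 * sqnorm u + 2 * sqnorm v.
Proof.
rewrite !mulr_sumr -big_split /=; apply: ler_sum => i _; rewrite !mxE.
by have := sqr_ge0 (u i 0 + v i 0); rewrite sqrrD sqrrB; lra.
Qed.

Lemma sqnorm_midpoint (R : realType) n (u v : 'cV[R]_n) :
  sqnorm (2^-1 *: (u + v)) =
  2^-1 * (sqnorm u + sqnorm v) - 4^-1 * sqnorm (u - v).
Proof.
rewrite /sqnorm -big_split !mulr_sumr -sumrB; apply: eq_bigr => i _.
by rewrite !mxE /=; field.
Qed.

Lemma gram_unit (R : realType) n p (X : 'M[R]_(n, p)) (m : R) : 0 < m ->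
  (forall v, m * sqnorm v <= sqnorm (X *m v)) -> X^T *m X \in unitmx.
Proof.
move=> m0 Xm; apply: posdef_unitmx => v v0; rewrite gram_formE.
apply: lt_le_trans (Xm v); rewrite pmulr_rgt0// lt_neqAle sqnorm_ge0 andbT.
apply: contraNneq v0 => /esym v0; apply/eqP/matrixP => i j.
rewrite ord1 mxE; apply/eqP; rewrite -sqrf_eq0 eq_le sqr_ge0 andbT -v0.
exact: coord_sqnorm.
Qed.

Lemma normal_equation (R : realType) n p (X : 'M[R]_(n, p)) (y : 'cV[R]_n) :
  X^T *m X \in unitmx -> X^T *m X *m betaLS X y = X^T *m y.
Proof. by move=> Xu; rewrite /betaLS !mulmxA mulmxV// mul1mx. Qed.

(** Pythagoras: by the normal equations the least squares residual is orthogonal to the columns of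
    [X]. *)
Lemma sqnorm_residual (R : realType) n p (X : 'M[R]_(n, p)) (y : 'cV[R]_n) b :
  X^T *m X \in unitmx ->
  sqnorm (y - X *m b) =
  sqnorm (y - X *m betaLS X y) + sqnorm (X *m (betaLS X y - b)).
Proof.
move=> Xu; set l := betaLS X y.
have -> : y - X *m b = (X *m (l - b)) + (y - X *m l).
  by rewrite mulmxBr [RHS]addrC subrKA.
have Xr : X^T *m (y - X *m l) = 0.
  by rewrite mulmxBr mulmxA normal_equation// subrr.
by rewrite [LHS]sqnormD trmx_mul -mulmxA Xr mulmx0 mxE mulr0 addr0 addrC.
Qed.

Lemma AL_objE (R : realType) n p (X : 'M[R]_(n, p)) lam (y : 'cV[R]_n) b :
  X^T *m X \in unitmx ->
  AL_obj X lam y b = sqnorm (y - X *m betaLS X y) +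
    sqnorm (X *m (betaLS X y - b)) +
    2 * \sum_(j < p) lam j * `|b j 0| / `|betaLS X y j 0|.
Proof. by move=> Xu; rewrite /AL_obj sqnorm_residual. Qed.

Lemma penalty_ge0 (R : realType) p (lam : 'I_p -> R) (l b : 'cV[R]_p) :
  (forall j, 0 <= lam j) -> 0 <= 2 * \sum_(j < p) lam j * `|b j 0| / `|l j 0|.
Proof.
by move=> lam0; rewrite mulr_ge0// sumr_ge0// => j _; rewrite divr_ge0// mulr_ge0.
Qed.

(** Strong convexity in midpoint form: the parallelogram identity gives the exact defect of the
    quadratic part, and the penalty is convex by the triangle inequality. *)
Lemma AL_obj_midpoint (R : realType) n p (X : 'M[R]_(n, p)) lam y b b' :
  (forall j, 0 <= lam j) ->
  4^-1 * sqnorm (X *m (b - b')) <=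
  2^-1 * (AL_obj X lam y b + AL_obj X lam y b')
  - AL_obj X lam y (2^-1 *: (b + b')).
Proof.
move=> lam0; rewrite /AL_obj; set l := betaLS X y.
have -> : y - X *m (2^-1 *: (b + b')) =
    2^-1 *: ((y - X *m b) + (y - X *m b')).
  rewrite -scalemxAr mulmxDr; apply/matrixP => i j; rewrite !mxE /=.
  by field.
rewrite sqnorm_midpoint.
have -> : y - X *m b - (y - X *m b') = - (X *m (b - b')).
  by rewrite mulmxBr [RHS]opprB opprB addrC subrKA.
rewrite sqnormN.
suff : \sum_(j < p) lam j * `|(2^-1 *: (b + b')) j 0| / `|l j 0| <=
    2^-1 * (\sum_(j < p) lam j * `|b j 0| / `|l j 0| +
            \sum_(j < p) lam j * `|b' j 0| / `|l j 0|) by lra.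
rewrite -big_split mulr_sumr; apply: ler_sum => j _ /=.
rewrite -mulrDl -mulrDr mulrA ler_wpM2r ?invr_ge0//.
rewrite mulrCA ler_wpM2l// !mxE normrM gtr0_norm ?invr_gt0//.
by rewrite ler_wpM2l ?invr_ge0// ler_normD.
Qed.

(** The map [g] allows both transposed row vectors, for the extreme value theorem, and column
    vectors themselves. *)
Lemma AL_obj_continuous (R : realType) n p (X : 'M[R]_(n, p)) lam y
    (U : topologicalType) (g : U -> 'cV[R]_p) :
  (forall j, continuous (fun u => g u j 0)) ->
  continuous (fun u => AL_obj X lam y (g u)).
Proof.
move=> cg u; apply: cvgD.
  rewrite /sqnorm; apply: cvg_big => [|i _]; first exact: add_continuous.
  have cx : (y - X *m g x) i 0 @[x --> u] --> (y - X *m g u) i 0.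
    under [X in X @ _ --> _]eq_fun do rewrite !mxE.
    rewrite !mxE; apply: cvgB; first exact: cvg_cst.
    apply: cvg_big => [|k _]; first exact: add_continuous.
    by apply: cvgM; [exact: cvg_cst|exact: cg].
  exact: (cvgM cx cx).
apply: cvgM; first exact: cvg_cst.
apply: cvg_big => [|k _]; first exact: add_continuous.
apply: cvgM; last exact: cvg_cst.
by apply: cvgM; [exact: cvg_cst|apply: cvg_norm; exact: cg].
Qed.

(** The extreme value theorem gives a minimizer on a box; outside the box, coercivity makes the
    objective at least its value at 0. *)
Lemma AL_minimizer_exists (R : realType) n p (X : 'M[R]_(n, p)) lam y (m : R) :
  (forall j, 0 <= lam j) -> 0 < m ->
  (forall v, m * sqnorm v <= sqnorm (X *m v)) ->
  exists b, forall b', AL_obj X lam y b <= AL_obj X lam y b'.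
Proof.
move=> lam0 m0 Xm; pose F (v : 'rV[R]_p) := AL_obj X lam y v^T.
(* The summand 1 gives [M <= M ^+ 2], so outside the box [m * sqnorm b'] is at least [4 * sqnorm y],
   which forces the residual to be at least [sqnorm y]. *)
pose M := 4 * sqnorm y / m + 1.
have y0 : 0 <= 4 * sqnorm y / m.
  by rewrite mulr_ge0 ?invr_ge0 ?(ltW m0)// mulr_ge0// sqnorm_ge0.
have M0 : 0 < M by rewrite ltr_wpDl.
pose A := [set v : 'rV[R]_p | forall j, v ord0 j \in `[- M, M]].
have cA : compact A.
  by apply: (@rV_compact R p (fun=> [set` `[- M, M]])) => j; exact: segment_compact.
have A0 : A !=set0.
  by exists 0 => j; rewrite mxE in_itv/= oppr_le0 ltW//= ltW.
have cF : continuous F.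
  apply: AL_obj_continuous => j.
  under eq_fun do rewrite mxE.
  exact: coord_continuous.
have [v vA vmin] := EVT_min_rV A0 cA (continuous_subspaceT cF).
exists v^T => b'.
have F0 : F v <= AL_obj X lam y 0.
  rewrite -[X in AL_obj _ _ _ X]trmx0; apply: vmin; rewrite inE => j.
  by rewrite mxE in_itv/= oppr_le0 ltW//= ltW.
have [b'A|b'A] := pselect (A b'^T).
  by have := vmin b'^T; rewrite /F trmxK; apply; rewrite inE.
apply: le_trans F0 _.
have [j Mj] : exists j, M < `|b' j 0|.
  apply: contrapT => /forallNP H; apply: b'A => j.
  rewrite mxE in_itv/=; have /negP := H j; rewrite -leNgt.
  by rewrite ler_norml.
have -> : AL_obj X lam y 0 = sqnorm y.
  rewrite /AL_obj mulmx0 subr0 big1 ?mulr0 ?addr0// => k _.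
  by rewrite mxE normr0 mulr0 mul0r.
have : sqnorm (X *m b') <= 2 * sqnorm y + 2 * sqnorm (y - X *m b').
  have := sqnormB_le y (y - X *m b'); rewrite opprB addrC subrK; exact: id.
have : 4 * sqnorm y <= m * sqnorm b'.
  rewrite -ler_pdivrMl// mulrC (le_trans _ (coord_sqnorm b' j))//.
  rewrite -(real_normK (num_real (b' j 0))).
  apply: (@le_trans _ _ (M ^+ 2)); last first.
    by rewrite ler_sqr ?nnegrE// ltW.
  rewrite (@le_trans _ _ M)//; first by rewrite lerDl.
  by rewrite expr2 ler_peMr ?(ltW M0)// lerDr.
have := Xm b'; have := penalty_ge0 (betaLS X y) b' lam0.
by rewrite /AL_obj; lra.
Qed.

Lemma betaAL_min (R : realType) n p (X : 'M[R]_(n, p)) lam y (m : R) :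
  (forall j, 0 <= lam j) -> 0 < m ->
  (forall v, m * sqnorm v <= sqnorm (X *m v)) ->
  forall b, AL_obj X lam y (betaAL X lam y) <= AL_obj X lam y b.
Proof.
move=> lam0 m0 Xm; rewrite /betaAL.
by case: xgetP => [b -> //|N b]; have [b0 /(N b0)] := AL_minimizer_exists y lam0 m0 Xm.
Qed.

(** Quadratic growth, from midpoint convexity between [b] and the minimizer: almost-minimizers are
    close to the minimizer. *)
Lemma betaAL_gap (R : realType) n p (X : 'M[R]_(n, p)) lam y (m : R) b :
  (forall j, 0 <= lam j) -> 0 < m ->
  (forall v, m * sqnorm v <= sqnorm (X *m v)) ->
  m * sqnorm (b - betaAL X lam y) <=
  2 * (AL_obj X lam y b - AL_obj X lam y (betaAL X lam y)).
Proof.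
move=> lam0 m0 Xm; apply: le_trans (Xm _) _.
have := AL_obj_midpoint X y b (betaAL X lam y) lam0.
have := betaAL_min y lam0 m0 Xm (2^-1 *: (b + betaAL X lam y)).
lra.
Qed.

Lemma betaAL_near_betaLS (R : realType) n p (X : 'M[R]_(n, p)) lam y (m : R) :
  (forall j, 0 <= lam j) -> 0 < m ->
  (forall v, m * sqnorm v <= sqnorm (X *m v)) ->
  m * sqnorm (betaAL X lam y - betaLS X y) <= 2 * \sum_j lam j.
Proof.
move=> lam0 m0 Xm; rewrite -sqnormN opprB; apply: le_trans (Xm _) _.
have := betaAL_min y lam0 m0 Xm (betaLS X y).
rewrite !(AL_objE _ _ _ (gram_unit m0 Xm)) subrr mulmx0 sqnorm0.
have := penalty_ge0 (betaLS X y) (betaAL X lam y) lam0.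
suff : \sum_(j < p) lam j * `|betaLS X y j 0| / `|betaLS X y j 0| <= \sum_j lam j.
  lra.
apply: ler_sum => j _; rewrite -mulrA ler_piMr//.
(* If the least squares coordinate is 0, the convention x / 0 = 0 makes the quotient 0, so the bound
   holds for every [y]. *)
have [->|l0] := eqVneq `|betaLS X y j 0| 0; first by rewrite mul0r.
by rewrite divff.
Qed.

Lemma sqnorm_gram_bound (R : realType) n p (X : 'M[R]_(n, p)) (M : R) v :
  (forall i j, `|(X^T *m X) i j| <= M) ->
  sqnorm (X *m v) <= M * p%:R * sqnorm v.
Proof.
move=> XM; rewrite -gram_formE (le_trans (ler_norm _))//.
exact: form_bound.
Qed.

Lemma gram_coord (R : realType) n p (X : 'M[R]_(n, p)) (u : 'cV[R]_p) (a : R) j :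
  ((X *m u)^T *m (X *m (a *: (delta_mx j 0 : 'cV[R]_p)))) 0 0 = a * (X^T *m X *m u) j 0.
Proof.
have dotC (v : 'cV[R]_n) : ((X *m u)^T *m v) 0 0 = (v^T *m (X *m u)) 0 0.
  by rewrite !mxE; apply: eq_bigr => i _; rewrite !mxE mulrC.
rewrite dotC trmx_mul linearZ /= trmx_delta.
have -> : a *: delta_mx 0 j *m X^T *m (X *m u) = a *: row j (X^T *m X *m u).
  by rewrite rowE -!mulmxA -!scalemxAl.
by move: (_ *m _ *m u) => w; rewrite !mxE.
Qed.

(* The minimality of the estimator against the same vector with its j-th
   coordinate a replaced by 0 stands in for the KKT condition. *)
Lemma betaAL_coord_penalty (R : realType) n p (X : 'M[R]_(n, p)) lam y (m : R) j :
  (forall j, 0 <= lam j) -> 0 < m ->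
  (forall v, m * sqnorm v <= sqnorm (X *m v)) ->
  let u := betaLS X y - betaAL X lam y in let a := betaAL X lam y j 0 in
  a != 0 ->
  lam j / `|betaLS X y j 0| <=
  `|(X^T *m X *m u) j 0| + `|a| * `|(X^T *m X) j j| / 2.
Proof.
move=> lam0 m0 Xm u a a0.
set A := X^T *m X; set l := betaLS X y.
pose v : 'cV[R]_p := a *: delta_mx j 0.
have := betaAL_min y lam0 m0 Xm (betaAL X lam y - v).
rewrite !(AL_objE _ _ _ (gram_unit m0 Xm)) -/l.
have -> : l - (betaAL X lam y - v) = u + v by rewrite opprB addrCA addrC.
rewrite -/u (mulmxDr X u v) (sqnormD (X *m u) (X *m v))
  (sqnormE (X *m v)) /v !gram_coord.
rewrite -/A -scalemxAr -colE.
have -> : (a *: col j A) j 0 = a * A j j by rewrite !mxE.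
rewrite (bigD1 j)//= [in X in _ <= X](bigD1 j)//= -/a.
have -> : (betaAL X lam y - a *: (delta_mx j 0 : 'cV[R]_p)) j 0 = 0.
  by rewrite !mxE !eqxx mulr1 subrr.
rewrite normr0 mulr0 mul0r add0r.
have -> : \sum_(i < p | i != j)
      lam i * `|(betaAL X lam y - a *: (delta_mx j 0 : 'cV[R]_p)) i 0| / `|l i 0| =
    \sum_(i < p | i != j) lam i * `|betaAL X lam y i 0| / `|l i 0|.
  apply: eq_bigr => i /negPf ij.
  by rewrite !mxE ij mulr0 subr0.
move=> H.
(* The penalties of the other coordinates cancel, and the comparison is halved because the penalty
   carries the factor 2. *)
have {}H : lam j * `|a| / `|l j 0| <= a * (A *m u) j 0 + a * (a * A j j) / 2.
  by move: H; lra.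
have a1 : 0 < `|a| by rewrite normr_gt0.
rewrite -(ler_pM2l a1) mulrA [_ * lam j]mulrC (le_trans H)// mulrDr lerD//.
  by rewrite -normrM ler_norm.
by rewrite !mulrA ler_pM2r// -!normrM ler_norm.
Qed.

(** If the coordinate were nonzero, [betaAL_coord_penalty] would bound the slope, which is at least
    [lam j / r], by [M * r * (p%:R * k + (1 + k) / 2)]. The condition on [betaLS X y j 0] excludes
    the case where x / 0 = 0 switches the penalty off. *)
Lemma betaAL_eq0 (R : realType) n p (X : 'M[R]_(n, p)) lam y (m M r k : R) j :
  (forall j, 0 <= lam j) -> 0 < m ->
  (forall v, m * sqnorm v <= sqnorm (X *m v)) ->
  (forall i j, `|(X^T *m X) i j| <= M) ->
  0 <= r -> sqnorm (betaLS X y) <= r ^+ 2 -> 0 <= k -> M * p%:R <= m * k ^+ 2 ->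
  M * r ^+ 2 * (p%:R * k + (1 + k) / 2) < lam j ->
  betaLS X y j 0 != 0 -> betaAL X lam y j 0 = 0.
Proof.
move=> lam0 m0 Xm XM r0 lr k0 Mk lamj l0; apply/eqP/negP => /negP a0.
have := betaAL_coord_penalty lam0 m0 Xm a0.
set u := betaLS X y - _; set a := betaAL X lam y j 0; set A := X^T *m X.
set l := betaLS X y in lr l0 u *.
have M0 : 0 <= M by exact: le_trans (XM j j).
(* Comparing the minimizer with 0 gives |X u| <= |X l|; the bounds [m] and [M] on the Gram matrix
   then transfer this to [u]. *)
have ur : sqnorm u <= (k * r) ^+ 2.
  rewrite -(ler_pM2l m0) (le_trans (Xm _))//.
  have : sqnorm (X *m u) <= sqnorm (X *m l).
    have := betaAL_min y lam0 m0 Xm 0.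
    rewrite !(AL_objE _ _ _ (gram_unit m0 Xm)) subr0 -/l -/u.
    have := penalty_ge0 l (betaAL X lam y) lam0.
    have -> : \sum_(i < p) lam i * `|(0 : 'cV[R]_p) i 0| / `|l i 0| = 0.
      by rewrite big1// => i _; rewrite mxE normr0 mulr0 mul0r.
    lra.
  move/le_trans; apply; apply: le_trans (sqnorm_gram_bound _ XM) _.
  rewrite exprMn mulrA (le_trans (ler_wpM2r (sqnorm_ge0 _) Mk))//.
  by rewrite ler_wpM2l// mulr_ge0 ?sqr_ge0// ltW.
have ui i : `|u i 0| <= k * r by apply: coord_sqnorm_le => //; exact: mulr_ge0.
have li i : `|l i 0| <= r by apply: coord_sqnorm_le.
have aj : `|a| <= (1 + k) * r.
  have -> : a = l j 0 - u j 0 by rewrite /u !mxE opprB addrC subrK.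
  by rewrite (le_trans (ler_normB _ _))// mulrDl mul1r lerD.
have Auj : `|(A *m u) j 0| <= M * (p%:R * (k * r)).
  rewrite mxE (le_trans (ler_norm_sum _ _ _))//.
  rewrite mulr_natl -[p in _ *+ p]card_ord -sumr_const mulr_sumr.
  by apply: ler_sum => i _; rewrite normrM ler_pM.
have lj : 0 < `|l j 0| by rewrite normr_gt0.
rewrite ler_pdivrMr// => H.
have Ajj : `|a| * `|A j j| / 2 <= (1 + k) * r * M / 2.
  by rewrite ler_pM2r// ler_pM.
have : lam j <= (M * (p%:R * (k * r)) + (1 + k) * r * M / 2) * r.
  apply: le_trans H _; rewrite ler_pM ?addr_ge0 ?divr_ge0 ?mulr_ge0//.
  by rewrite lerD.
apply/negP; rewrite -ltNge; apply: le_lt_trans lamj.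
by rewrite le_eqVlt; apply/orP; left; apply/eqP; field.
Qed.

(** * Measurability *)

Lemma rational_cV_dense (R : realType) p (v : 'cV[R]_p) (A : set 'cV[R]_p) :
  nbhs v A -> exists q : 'cV[rat]_p, A (map_mx ratr q).
Proof.
move=> /nbhs_ballP[e /= e0 eA].
have q i : {q : rat | v i 0 - e < ratr q < v i 0 + e}.
  apply: cid; have [|q] := @rat_in_itvoo R (v i 0 - e) (v i 0 + e).
    by rewrite ltrD2l; lra.
  by rewrite in_itv; exists q.
exists (\col_i sval (q i)); apply: eA; split=> // i j; rewrite ord1 !mxE.
rewrite -ball_normE /ball_ /= ltr_distlC.
by case: (q i).
Qed.

Lemma measurable_betaLS (R : realType) d (T : measurableType d) n p
    (X : 'M[R]_(n, p)) (Y : T -> 'cV[R]_n) j :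
  (forall i, measurable_fun setT (fun w => Y w i 0)) ->
  measurable_fun setT (fun w => betaLS X (Y w) j 0).
Proof.
move=> mY; under eq_fun do rewrite mxE.
by apply: measurable_sum => i; apply: measurable_funM.
Qed.

Lemma measurable_AL_obj (R : realType) d (T : measurableType d) n p
    (X : 'M[R]_(n, p)) lam (Y : T -> 'cV[R]_n) b :
  (forall i, measurable_fun setT (fun w => Y w i 0)) ->
  measurable_fun setT (fun w => AL_obj X lam (Y w) b).
Proof.
move=> mY; apply: measurable_funD.
  apply: measurable_sum => i; apply: measurable_funX.
  under eq_fun do rewrite !mxE.
  by apply: measurable_funB.
apply: measurable_funM => //; apply: measurable_sum => j.
apply: measurable_funM => //.
(* Inversion is not continuous at 0; on nonnegative reals it agrees with a power function, 0
   included, and power functions are measurable. *)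
have -> : (fun w => `|betaLS X (Y w) j 0|^-1) =
    (fun x => x `^ (-1)) \o (fun w => `|betaLS X (Y w) j 0|).
  by apply/funext => w /=; rewrite powR_inv1.
apply: measurableT_comp; first exact: measurable_powR.
by apply: measurableT_comp => //; exact: measurable_betaLS.
Qed.

(* Strong convexity turns "the coordinate is below c" into a countable
   statement about rational almost-minimizers. *)
Lemma measurable_betaAL (R : realType) d (T : measurableType d) n p
    (X : 'M[R]_(n, p)) lam (Y : T -> 'cV[R]_n) (m : R) j :
  (forall i, measurable_fun setT (fun w => Y w i 0)) ->
  (forall j, 0 <= lam j) -> 0 < m ->
  (forall v, m * sqnorm v <= sqnorm (X *m v)) ->
  measurable_fun setT (fun w => betaAL X lam (Y w) j 0).
Proof.
move=> mY lam0 m0 Xm.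
pose F w b := AL_obj X lam (Y w) b.
pose q2v (q : 'cV[rat]_p) : 'cV[R]_p := map_mx ratr q.
pose U : Type := ('cV[rat]_p * rat)%type.
pose cond (c : R) (u : U) := [&& 0 < u.2 & q2v u.1 j 0 + ratr u.2 < c].
(* With this slack, [betaAL_gap] puts an almost-minimizer within distance [ratr u.2] of the
   estimator. *)
pose slack (u : U) : R := m * ratr u.2 ^+ 2 / 2.
pose near (u : U) := \bigcap_(q : 'cV[rat]_p) [set w | F w (q2v u.1) <= F w (q2v q) + slack u].
have cF w : continuous (F w).
  by apply: (@AL_obj_continuous _ _ _ _ _ _ 'cV[R]_p id) => i; exact: coord_continuous.
apply: (measurability _ (RGenInftyO.measurableE R)) => _ [_ [c ->]] <-.
rewrite setTI.
have -> : (fun w => betaAL X lam (Y w) j 0) @^-1` `]-oo, c[%classic =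
    \bigcup_(u : U) (if cond c u then near u else set0).
  apply/seteqP; split => [w /=|w [u _]].
    rewrite in_itv/= => bc; set b := betaAL X lam (Y w) in bc *.
    (* Half of the room below [c] goes to the distance from [b] to the rational point, half to the
       radius [s]. *)
    pose s0 := (c - b j 0) / 2.
    have s00 : 0 < s0 by rewrite divr_gt0// subr_gt0.
    have [s] := rat_in_itvoo s00; rewrite in_itv/= => /andP[sgt0 ss0].
    have nF : \forall b' \near b,
        F w b' < F w b + m * ratr s ^+ 2 / 2 /\ `|b j 0 - b' j 0| < s0.
      near=> b'; split.
        near: b'; apply: (cvgr_lt (F w b)); first exact: cF.
        by rewrite ltrDl divr_gt0// mulr_gt0// exprn_gt0.
      near: b'; have /cvgrPdist_lt := @coord_continuous R p 1 j 0 b.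
      by apply.
    have [q [qF qj]] := rational_cV_dense nF.
    exists (q, s) => //; rewrite ifT; last first.
      rewrite /cond /=; apply/andP; split; first by rewrite -(ltr0q R).
      move: qj; rewrite ltr_distlC /q2v /s0 => /andP[_]; move: ss0; rewrite /s0; lra.
    move=> q' _ /=; rewrite (le_trans (ltW qF))// lerD2r.
    exact: betaAL_min m0 Xm _.
  case: ifP => // /andP[]; case: u => q s /= s0 qc wu.
  (* Membership in [near] compares with rational points only; density and continuity extend the
     comparison to the minimizer. *)
  have {wu} H : F w (q2v q) <= F w (betaAL X lam (Y w)) + slack (q, s).
    apply/ler_addgt0Pl => e e0.
    have nF : \forall b' \near betaAL X lam (Y w), F w b' < F w (betaAL X lam (Y w)) + e.
      by apply: (cvgr_lt _ (cF w (betaAL X lam (Y w)))); rewrite ltrDl.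
    have [q' q'F] := rational_cV_dense nF.
    have /= := wu q' Logic.I; rewrite -/(q2v q') in q'F; lra.
  have sR : 0 < ratr s :> R by rewrite ltr0q.
  have : sqnorm (q2v q - betaAL X lam (Y w)) <= ratr s ^+ 2.
    rewrite -(ler_pM2l m0); apply: le_trans (betaAL_gap _ _ lam0 m0 Xm) _.
    by move: H; rewrite /F /slack /=; lra.
  move=> /(coord_sqnorm_le j (ltW sR)); rewrite !mxE ler_distl => /andP[+ _].
  by rewrite in_itv/=; move: qc; rewrite /q2v mxE; lra.
apply: countable_bigcupT_measurable => [|u]; first exact: countableP.
case: ifP => // _; rewrite /near.
rewrite -[X in measurable X]setCK setC_bigcap; apply: measurableC.
apply: countable_bigcupT_measurable => [|q]; first exact: countableP.
apply: measurableC; rewrite -[X in measurable X]setTI.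
apply: measurable_fun_le => //; first exact: measurable_AL_obj.
by apply: measurable_funD => //; exact: measurable_AL_obj.
Unshelve. all: by end_near.
Qed.

Lemma measurable_sqnorm (R : realType) d (T : measurableType d) n
    (Y : T -> 'cV[R]_n) :
  (forall i, measurable_fun setT (fun w => Y w i 0)) ->
  measurable_fun setT (fun w => sqnorm (Y w)).
Proof. by move=> mY; apply: measurable_sum => i; exact: measurable_funX. Qed.

Lemma enorm_le (R : realType) n (v : 'cV[R]_n) (e : R) : 0 <= e ->
  (enorm v <= e) = (sqnorm v <= e ^+ 2).
Proof.
by move=> e0; rewrite -{1}(ger0_norm e0) -sqrtr_sqr ler_sqrt// sqr_ge0.
Qed.

Lemma measurable_gt_sqnorm (R : realType) d (T : measurableType d) n
    (Y : T -> 'cV[R]_n) (s : R) :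
  (forall i, measurable_fun setT (fun w => Y w i 0)) ->
  measurable [set w | s < sqnorm (Y w)].
Proof.
move=> mY; have -> : [set w | s < sqnorm (Y w)] = ~` [set w | sqnorm (Y w) <= s].
  by apply/seteqP; split => w /=; rewrite ltNge => /negP.
apply: measurableC; rewrite -[X in measurable X]setTI.
by apply: measurable_fun_le => //; exact: measurable_sqnorm.
Qed.

Lemma measurable_gt_enorm (R : realType) d (T : measurableType d) n
    (Y : T -> 'cV[R]_n) (e : R) :
  (forall i, measurable_fun setT (fun w => Y w i 0)) -> 0 < e ->
  measurable [set w | e < enorm (Y w)].
Proof.
move=> mY e0.
under eq_set do rewrite ltNge enorm_le ?(ltW e0)// -ltNge.
exact: measurable_gt_sqnorm.
Qed.

(** * Second moments of weighted sums of the errors *)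

Local Open Scope ereal_scope.

(** Independence identifies the joint law with the product of the marginal laws; Tonelli gives
    integrability and Fubini the factorization. *)
Lemma indep_integralM (R : realType) d (T : measurableType d)
    (P : probability T R) (X Y : {RV P >-> R}) :
  (forall A B, measurable A -> measurable B ->
    P (X @^-1` A `&` Y @^-1` B) = P (X @^-1` A) * P (Y @^-1` B)) ->
  P.-integrable setT (EFin \o X) -> P.-integrable setT (EFin \o Y) ->
  P.-integrable setT (fun w => (X w * Y w)%:E) /\
  \int[P]_w (X w * Y w)%:E = \int[P]_w (X w)%:E * \int[P]_w (Y w)%:E.
Proof.
move=> XY iX iY.
pose XYf w := (X w, Y w).
have mXY : measurable_fun setT XYf by exact: measurable_fun_pair.
pose XYm : {RV P >-> (R * R)%type} :=
  HB.pack XYf (isMeasurableFun.Build _ _ _ _ XYf mXY).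
pose m1 := distribution P X; pose m2 := distribution P Y.
have jointE A : measurable A -> (m1 \x m2) A = distribution P XYm A.
  by move=> mA; apply: product_measure_unique => //.
pose f (z : R * R) := (z.1 * z.2)%:E.
have mf : measurable_fun setT f.
  by apply/measurable_EFinP; apply: measurable_funM.
have iD (Z : {RV P >-> R}) : P.-integrable setT (EFin \o Z) ->
    (distribution P Z).-integrable setT (EFin \o id).
  move=> /integrableP[_ Zoo]; apply/integrableP; split.
    exact/measurable_EFinP.
  rewrite (ge0_integral_distribution Z (f := abse \o EFin))// => [|y].
    exact/measurableT_comp/measurable_EFinP.
  exact: abse_ge0.
have i1 := iD _ iX; have i2 := iD _ iY.
have eD (Z : {RV P >-> R}) : P.-integrable setT (EFin \o Z) ->
    \int[distribution P Z]_x x%:E = \int[P]_w (Z w)%:E.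
  move=> iZ; rewrite (integral_distribution (f := EFin))//.
have eY : \int[m2]_y y%:E \is a fin_num by exact: integrable_fin_num i2.
have aY : \int[m2]_y `|y%:E| \is a fin_num.
  by apply: integrable_fin_num => //; exact: integrable_abse i2.
have mabs : measurable_fun setT (fun x : R => `|x|%:E).
  by apply/measurable_EFinP; exact: normr_measurable.
have if12 : (m1 \x m2).-integrable setT f.
  apply/integrable12ltyP => //.
  under eq_integral => x _.
    under eq_integral => y _ do rewrite /f /= normrM EFinM.
    rewrite ge0_integralZl//=.
    rewrite -(fineK aY) muleC.
    over.
  rewrite ge0_integralZl//=.
  - apply: lte_mul_pinfty => //.
    + by rewrite lee_fin fine_ge0// integral_ge0.
    + by case/integrableP: i1.
  - by rewrite lee_fin fine_ge0// integral_ge0.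
have iXY : P.-integrable setT (f \o XYm).
  apply/integrableP; split; first exact: measurableT_comp.
  rewrite -(ge0_integral_distribution XYm (f := abse \o f)); last 2 first.
  - exact: measurableT_comp.
  - by move=> y; exact: abse_ge0.
  rewrite (eq_measure_integral (m1 \x m2)); last first.
    by move=> A mA _; apply/esym; exact: jointE.
  by case/integrableP : if12.
split; first exact: iXY.
have := integral_distribution mf iXY.
rewrite /comp/= => <-.
rewrite (eq_measure_integral (m1 \x m2)); last first.
    by move=> A mA _; apply/esym; exact: jointE.
rewrite -integral12_prod_meas1// /fubini_F.
under eq_integral => x _.
  under eq_integral => y _ do rewrite /f /= EFinM.
  rewrite integralZl//= -(fineK eY) muleC.
  over.
by rewrite integralZl//= fineK// muleC !eD.
Qed.

Local Close Scope ereal_scope.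

(** Joint independence is applied with the full space at all indices other than [i] and [j]. *)
Lemma pairwise_indep (R : realType) d (T : measurableType d)
    (P : probability T R) (eps : nat -> T -> R) :
  (forall (n : nat) (B : 'I_n -> set R), (forall i, measurable (B i)) ->
     P [set w | forall i : 'I_n, B i (eps (nat_of_ord i) w)]
     = (\prod_(i < n) P (eps (nat_of_ord i) @^-1` B i))%E) ->
  forall i j A B, i != j -> measurable A -> measurable B ->
  P (eps i @^-1` A `&` eps j @^-1` B) =
  (P (eps i @^-1` A) * P (eps j @^-1` B))%E.
Proof.
move=> ind i j A B ij mA mB; pose n := (maxn i j).+1.
have ni : (i < n)%N by rewrite ltnS leq_maxl.
have nj : (j < n)%N by rewrite ltnS leq_maxr.
pose D (k : 'I_n) := if k == i :> nat then A else if k == j :> nat then B else setT.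
have mD k : measurable (D k) by rewrite /D; case: ifP => // _; case: ifP.
have Di : D (Ordinal ni) = A by rewrite /D eqxx.
have Dj : D (Ordinal nj) = B by rewrite /D /= eq_sym (negPf ij) eqxx.
have -> : eps i @^-1` A `&` eps j @^-1` B =
    [set w | forall k : 'I_n, D k (eps (nat_of_ord k) w)].
  apply/seteqP; split => [w [Aw Bw] k|w /= Dw].
    by rewrite /D; case: eqP => [->//|_]; case: eqP => [->//|].
  split; first by have := Dw (Ordinal ni); rewrite Di.
  by have := Dw (Ordinal nj); rewrite Dj.
rewrite ind// (bigD1 (Ordinal ni))//= (bigD1 (Ordinal nj))//=; last first.
  by rewrite -val_eqE /= eq_sym.
rewrite Di Dj big1 ?mule1// => k /andP[ki kj].
rewrite /D; move: ki kj; rewrite -!val_eqE /= => /negPf -> /negPf ->.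
by rewrite preimage_setT probability_setT.
Qed.

Lemma ge0_integral_ident (R : realType) d (T : measurableType d)
    (P : probability T R) (X Y : {RV P >-> R}) (f : R -> \bar R) :
  (forall B : set R, measurable B -> P (X @^-1` B) = P (Y @^-1` B)) ->
  measurable_fun setT f -> (forall x, 0 <= f x)%E ->
  (\int[P]_w f (X w) = \int[P]_w f (Y w))%E.
Proof.
move=> XY mf f0; have := ge0_integral_distribution X mf f0.
rewrite /comp => <-; have := ge0_integral_distribution Y mf f0.
rewrite /comp => <-; apply: eq_measure_integral => B mB _; exact: XY.
Qed.

Lemma integral_ident (R : realType) d (T : measurableType d)
    (P : probability T R) (X Y : {RV P >-> R}) :
  (forall B : set R, measurable B -> P (X @^-1` B) = P (Y @^-1` B)) ->
  P.-integrable setT (EFin \o Y) ->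
  P.-integrable setT (EFin \o X) /\
  (\int[P]_w (X w)%:E = \int[P]_w (Y w)%:E)%E.
Proof.
move=> XY iY.
have iX : P.-integrable setT (EFin \o X).
  apply/integrableP; split; first exact/measurable_EFinP.
  have -> : (\int[P]_x `|(EFin \o X) x| = \int[P]_x `|(EFin \o Y) x|)%E.
    apply: (ge0_integral_ident (f := abse \o EFin)) => //.
      exact/measurableT_comp/measurable_EFinP.
    by move=> x; exact: abse_ge0.
  by case/integrableP : iY.
split=> //; have mE : measurable_fun setT (@EFin R) by exact/measurable_EFinP.
have := integral_distribution mE iX; rewrite /comp => <-.
have := integral_distribution mE iY; rewrite /comp => <-.
by apply: eq_measure_integral => B mB _; exact: XY.
Qed.

(** After expanding the square, the cross terms vanish by independence and zero mean, and each
    diagonal term contributes [sigma2]. *)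
Lemma weighted_sum_second_moment (R : realType) d (T : measurableType d)
    (P : probability T R) (eps : nat -> T -> R) (sigma2 : R) :
  (forall i, measurable_fun setT (eps i)) ->
  (forall (n : nat) (B : 'I_n -> set R), (forall i, measurable (B i)) ->
     P [set w | forall i : 'I_n, B i (eps (nat_of_ord i) w)]
     = (\prod_(i < n) P (eps (nat_of_ord i) @^-1` B i))%E) ->
  (forall i (B : set R), measurable B ->
     P (eps i @^-1` B) = P (eps 0%N @^-1` B)) ->
  P.-integrable setT (fun w => (eps 0%N w)%:E) ->
  (\int[P]_w (eps 0%N w)%:E = 0)%E ->
  (\int[P]_w ((eps 0%N w) ^+ 2)%:E = sigma2%:E)%E ->
  forall n (a : 'I_n -> R),
  (\int[P]_w ((\sum_(i < n) a i * eps i w) ^+ 2)%:E =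
   (sigma2 * \sum_(i < n) a i ^+ 2)%:E)%E.
Proof.
move=> meps ind idd int0 mean0 var n a.
pose E i : {RV P >-> R} :=
  HB.pack (eps i) (isMeasurableFun.Build _ _ _ _ (eps i) (meps i)).
have iE i := @integral_ident R d T P (E i) (E 0%N) (idd i) int0.
have var_i i : (\int[P]_w (eps i w ^+ 2)%:E = sigma2%:E)%E.
  rewrite -var.
  apply: (@ge0_integral_ident R d T P (E i) (E 0%N) (fun x => (x ^+ 2)%:E) (idd i)).
    by apply/measurable_EFinP; exact: measurable_funX.
  by move=> x; rewrite lee_fin sqr_ge0.
have cross (i j : nat) : P.-integrable setT (fun w => (eps i w * eps j w)%:E) /\
    (\int[P]_w (eps i w * eps j w)%:E = (if i == j then sigma2 else 0)%:E)%E.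
  have [<-|ij] := eqVneq i j.
    split; last exact: var_i.
    apply/integrableP; split.
      by apply/measurable_EFinP; exact: measurable_funM.
    under eq_integral do rewrite gee0_abs ?lee_fin ?sqr_ge0//.
    by have := var_i i; rewrite /= => ->; rewrite ltry.
  have [iM ->] := @indep_integralM R d T P (E i) (E j)
    (fun A B => @pairwise_indep R d T P eps ind i j A B ij) (iE i).1 (iE j).1.
  split; first exact: iM.
  by rewrite (iE i).2 mean0 mul0e.
have -> : (\int[P]_w ((\sum_(i < n) a i * eps i w) ^+ 2)%:E =
    \int[P]_w \sum_(i < n) \sum_(j < n) ((a i * a j)%:E * (eps i w * eps j w)%:E))%E.
  apply: eq_integral => w _; rewrite expr2 mulr_suml -sumEFin.
  apply: eq_bigr => i _; rewrite mulr_sumr -sumEFin; apply: eq_bigr => j _.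
  by rewrite -EFinM; congr EFin; ring.
have iZ i j : P.-integrable setT (fun w =>
    (a i * a j)%:E * (eps (nat_of_ord i) w * eps (nat_of_ord j) w)%:E)%E.
  by apply: integrableZl => //; exact: (cross i j).1.
rewrite integral_sum//; last by move=> i; apply: integrable_sum => // j _.
rewrite mulr_sumr -sumEFin; apply: eq_bigr => i _.
rewrite integral_sum// (bigD1 i)//= big1 => [|j ji].
  rewrite integralZl//; last exact: (cross i i).1.
  by rewrite (cross i i).2 eqxx adde0 -EFinM mulrC expr2.
rewrite integralZl//; last exact: (cross i j).1.
by rewrite (cross i j).2 eq_sym -val_eqE in ji *; rewrite (negPf ji) mule0.
Qed.

(** * Deviation of the least squares estimator *)

Lemma measurable_resp (R : realType) d (T : measurableType d) n p
    (X : 'M[R]_(n, p)) beta (eps : nat -> T -> R) i :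
  (forall i, measurable_fun setT (eps i)) ->
  measurable_fun setT (fun w => resp X beta eps w i 0).
Proof.
move=> meps; under eq_fun do rewrite /resp mxE [X in _ + X]mxE.
exact: measurable_funD.
Qed.

Lemma betaLS_error (R : realType) n p (X : 'M[R]_(n, p)) (m : R) beta e :
  0 < m -> (forall v, m * sqnorm v <= sqnorm (X *m v)) ->
  m ^+ 2 * sqnorm (betaLS X (X *m beta + e) - beta) <= sqnorm (X^T *m e).
Proof.
move=> m0 Xm; set v := _ - beta; set Z := X^T *m e.
have Av : X^T *m X *m v = Z.
  by rewrite mulmxBr normal_equation ?(gram_unit m0)// mulmxDr mulmxA addrC addKr.
have : sqnorm (X *m v) = (v^T *m Z) 0 0 by rewrite -gram_formE -mulmxA Av.
have := Xm v; move=> /[swap] ->.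
(* Expanding this square takes the place of Cauchy-Schwarz between [v] and [Z]. *)
have : 0 <= sqnorm (m *: v - Z) by exact: sqnorm_ge0.
rewrite (sqnormD (m *: v)) sqnormN.
have -> : sqnorm (m *: v) = m ^+ 2 * sqnorm v.
  by rewrite /sqnorm mulr_sumr; apply: eq_bigr => i _; rewrite mxE exprMn.
have -> : ((m *: v)^T *m - Z) 0 0 = - m * (v^T *m Z) 0 0.
  by rewrite !mxE mulr_sumr; apply: eq_bigr => i _; rewrite !mxE; ring.
move: (sqnorm v) (sqnorm Z) ((v^T *m Z) 0 0) => a b x H1 H2.
have : m * (m * a) <= m * x by rewrite ler_pM2l.
rewrite expr2; lra.
Qed.

(** Markov's inequality for |X'eps|^2, whose mean is [sigma2] times the trace of X'X. The bound is
    free of [beta], which is the source of uniformity. *)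
Lemma betaLS_deviation (R : realType) d (T : measurableType d)
    (P : probability T R) (eps : nat -> T -> R) (sigma2 c K s : R) n p
    (X : 'M[R]_(n, p)) beta :
  (forall i, measurable_fun setT (eps i)) ->
  (forall (a : 'I_n -> R),
    (\int[P]_w ((\sum_(i < n) a i * eps i w) ^+ 2)%:E =
     (sigma2 * \sum_(i < n) a i ^+ 2)%:E)%E) ->
  0 <= sigma2 -> 0 < c -> 0 < s -> (0 < n)%N ->
  (forall v, n%:R * c * sqnorm v <= sqnorm (X *m v)) ->
  (forall i j, `|(X^T *m X) i j| <= n%:R * K) ->
  (P [set w | (s < sqnorm (betaLS X (resp X beta eps w) - beta))%R] <=
   (p%:R * K * sigma2 / c ^+ 2 / s / n%:R)%:E)%E.
Proof.
move=> meps moment sigma0 c0 s0 n0 Xc XK.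
have nR : 0 < n%:R :> R by rewrite ltr0n.
have m0 : 0 < n%:R * c by rewrite mulr_gt0.
pose Z w : 'cV[R]_p := X^T *m \col_(i < n) eps (nat_of_ord i) w.
have Zk w k : Z w k 0 = \sum_(i < n) X i k * eps i w.
  by rewrite mxE; apply: eq_bigr => i _; rewrite !mxE.
have mZ k : measurable_fun setT (fun w => Z w k 0).
  under eq_fun do rewrite Zk.
  by apply: measurable_sum => i; exact: measurable_funM.
have mSZ := measurable_sqnorm mZ.
have EZ : (\int[P]_w (sqnorm (Z w))%:E <= (n%:R * (p%:R * K * sigma2))%:E)%E.
  under eq_integral => w _ do rewrite /sqnorm -sumEFin.
  rewrite ge0_integral_sum//; last 2 first.
  - by move=> k; apply/measurable_EFinP; exact: measurable_funX.
  - by move=> k w _; rewrite lee_fin sqr_ge0.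
  under eq_bigr => k _.
    under eq_integral => w _ do rewrite Zk.
    rewrite moment.
    over.
  rewrite sumEFin lee_fin.
  have -> : n%:R * (p%:R * K * sigma2) = \sum_(k < p) sigma2 * (n%:R * K).
    by rewrite sumr_const card_ord -[RHS]mulr_natl; ring.
  apply: ler_sum => k _; rewrite ler_wpM2l//.
  apply: le_trans (XK k k); apply: le_trans (ler_norm _).
  rewrite mxE le_eqVlt; apply/orP; left; apply/eqP.
  by apply: eq_bigr => i _; rewrite mxE expr2.
pose a := (n%:R * c) ^+ 2 * s.
have a0 : 0 < a by rewrite mulr_gt0// exprn_gt0.
have mk : (a%:E * P [set w | (a <= sqnorm (Z w))%R] <=
    \int[P]_w (sqnorm (Z w))%:E)%E.
  have := @le_integral_comp_abse d T R P setT measurableT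
    (fun w => (sqnorm (Z w))%:E) a id (@measurable_id _ _ setT)
    (fun r r0 => r0) (fun x y _ _ xy => xy) (proj2 (measurable_EFinP _ _) mSZ) a0.
  have absZ w : `|(sqnorm (Z w))%:E|%E = (sqnorm (Z w))%:E.
    by rewrite gee0_abs// lee_fin sqnorm_ge0.
  rewrite setTI; under eq_integral do rewrite absZ.
  by under [X in (_ * P X)%E]eq_set do rewrite absZ lee_fin.
have sub : [set w | s < sqnorm (betaLS X (resp X beta eps w) - beta)] `<=`
    [set w | a <= sqnorm (Z w)].
  move=> w /= sw; apply: le_trans (betaLS_error _ _ m0 Xc).
  by rewrite /a ler_pM2l ?exprn_gt0//; exact: (ltW sw).
have mS : measurable [set w | a <= sqnorm (Z w)].
  rewrite -[X in measurable X]setTI; exact: measurable_fun_le.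
have mD : measurable [set w | s < sqnorm (betaLS X (resp X beta eps w) - beta)].
  have mB i : measurable_fun setT
      (fun w => (betaLS X (resp X beta eps w) - beta) i 0).
    under eq_fun do rewrite mxE [X in _ + X]mxE.
    apply: measurable_funD => //; apply: measurable_betaLS => k.
    exact: measurable_resp.
  exact: measurable_gt_sqnorm.
apply: (@le_trans _ _ (P [set w | a <= sqnorm (Z w)])).
  by apply: le_measure => //; rewrite inE.
rewrite -(@lee_pmul2l _ a%:E)// (le_trans mk)// (le_trans EZ)// -EFinM lee_fin.
rewrite le_eqVlt; apply/orP; left; apply/eqP; rewrite /a; field.
by rewrite !gt_eqF.
Qed.

(** * Consistency *)

Lemma cvge0_lt (R : realType) (f : nat -> \bar R) (r : R) :
  f @ \oo --> 0%E -> 0 < r -> \forall n \near \oo, (f n < r%:E)%E.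
Proof.
move=> /fine_cvgP[fin /cvgrPdist_lt f0] r0; near=> n.
rewrite -(@fineK _ (f n)); last by near: n.
rewrite lte_fin; have : `|0 - fine (f n)| < r by near: n; exact: f0.
by rewrite sub0r normrN; apply: le_lt_trans; exact: ler_norm.
Unshelve. all: by end_near.
Qed.

Lemma cvge0_le (R : realType) (f : nat -> \bar R) :
  (forall r : R, 0 < r -> \forall n \near \oo, (0 <= f n <= r%:E)%E) ->
  f @ \oo --> 0%E.
Proof.
move=> f0.
apply/fine_cvgP; split.
  have := f0 1 ltr01; apply: filterS => n /andP[f1 f2].
  by rewrite ge0_fin_numE// (le_lt_trans f2)// ltry.
apply/cvgrPdist_le => r r0; have := f0 r r0; apply: filterS => n /andP[f1 f2].
rewrite sub0r normrN /= ger0_norm ?fine_ge0//.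
by rewrite -lee_fin fineK// ge0_fin_numE// (le_lt_trans f2)// ltry.
Qed.

Lemma inv_nat_eventually_le (R : realType) (b r : R) : 0 < r ->
  \forall n \near \oo, b / n%:R <= r.
Proof.
move=> r0; near=> n.
have n0 : 0 < n%:R :> R.
  by rewrite ltr0n; near: n; exact: nbhs_infty_gt.
rewrite ler_pdivrMr// mulrC -ler_pdivrMr//.
near: n; exact: nbhs_infty_ger.
Unshelve. all: by end_near.
Qed.

Lemma lam_le_star (R : realType) p (lam : 'I_p -> R) j : lam j <= lam_star lam.
Proof. exact: le_bigmax. Qed.

Lemma lam_star_ge0 (R : realType) p (lam : 'I_p -> R) : 0 <= lam_star lam.
Proof. exact: bigmax_ge_id. Qed.

(** Finitely many coordinates share a common threshold in [n]; the start value 0 of the maximum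
    provides the lower bound. *)
Lemma lam_star_cvg0 (R : realType) p (lam : nat -> 'I_p -> R) :
  (forall r j, 0 < r -> \forall n \near \oo, lam n j / n%:R < r) ->
  (fun n => lam_star (lam n) / n%:R) @ \oo --> (0 : R).
Proof.
move=> lamr; apply/cvgrPdist_lt => r r0.
have : \forall n \near \oo, (0 < n)%N /\ forall j, lam n j / n%:R < r.
  near=> n; split; first by near: n; exact: nbhs_infty_gt.
  by near: n; apply: filter_forall => j; exact: lamr.
apply: filterS => n [n0 nr]; have nR : 0 < n%:R :> R by rewrite ltr0n.
rewrite sub0r normrN ger0_norm ?divr_ge0 ?lam_star_ge0//.
rewrite ltr_pdivrMr//; apply: bigmax_lt => [|j _]; first exact: mulr_gt0.
by rewrite -ltr_pdivrMr.
Unshelve. all: by end_near.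
Qed.

(** Here [e] bounds a squared norm. The two estimators differ by at most [e / 8] in squared norm, so
    [sqnormB_le] leaves more than 3e/8 for the least squares error. *)
Lemma betaAL_error (R : realType) n p (X : 'M[R]_(n, p)) lam y beta (m e : R) :
  (forall j, 0 <= lam j) -> 0 < m ->
  (forall v, m * sqnorm v <= sqnorm (X *m v)) ->
  2 * p%:R * lam_star lam <= m * (e / 8) ->
  e < sqnorm (betaAL X lam y - beta) -> e / 4 < sqnorm (betaLS X y - beta).
Proof.
move=> lam0 m0 Xm le.
have : sqnorm (betaAL X lam y - betaLS X y) <= e / 8.
  rewrite -(ler_pM2l m0) (le_trans (betaAL_near_betaLS y lam0 m0 Xm))//.
  apply: le_trans le; rewrite -mulrA ler_wpM2l//.
  apply: (le_trans (ler_sum _ (fun j _ => lam_le_star lam j))).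
  by rewrite sumr_const card_ord mulr_natl.
have := sqnormB_le (betaAL X lam y - betaLS X y) (beta - betaLS X y).
have -> : betaAL X lam y - betaLS X y - (beta - betaLS X y) = betaAL X lam y - beta.
  by rewrite opprB subrKA.
have := sqnorm_ge0 (betaAL X lam y - betaLS X y).
rewrite -(sqnormN (beta - _)) opprB; lra.
Qed.

(* With beta = t e_j and t small, the least squares estimator is of order t, so
   the penalty slope at the j-th coordinate is of order lam_j / t, which
   dominates the O(n t) gradient of the residual sum of squares. *)
Lemma betaAL_selects_out (R : realType) n p (X : 'M[R]_(n, p)) lam y
    (c K k t : R) j :
  (forall j, 0 <= lam j) -> 0 < n%:R * c ->
  (forall v, n%:R * c * sqnorm v <= sqnorm (X *m v)) ->
  (forall i j, `|(X^T *m X) i j| <= n%:R * K) ->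
  0 <= k -> K * p%:R <= c * k ^+ 2 -> 0 < t ->
  n%:R * (4 * K * (p%:R * k + (1 + k) / 2) * t ^+ 2) < lam j ->
  sqnorm (betaLS X y - t *: delta_mx j 0) <= t ^+ 2 / 4 ->
  betaAL X lam y j 0 = 0.
Proof.
move=> lam0 m0 Xm XK k0 Kk t0 lamj lt.
have t20 : 0 <= t / 2 by rewrite divr_ge0// ltW.
(* The radius [2 * t] works because the squared norm of the least squares estimator is at most 2
   (t^2 / 4) + 2 t^2. *)
apply: (@betaAL_eq0 _ _ _ _ _ _ (n%:R * c) (n%:R * K) (2 * t) k) => //.
- by rewrite mulr_ge0// ltW.
- have St : sqnorm (t *: delta_mx j 0 : 'cV[R]_p) = t ^+ 2.
    rewrite /sqnorm (bigD1 j)//= big1 => [|i /negPf ij].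
      by rewrite !mxE !eqxx mulr1 addr0.
    by rewrite !mxE ij mulr0 expr0n.
  have := sqnormB_le (betaLS X y - t *: delta_mx j 0) (- (t *: delta_mx j 0)).
  rewrite opprK subrK sqnormN St exprMn; have := sqr_ge0 t; lra.
- by rewrite -!mulrA ler_wpM2l.
- apply: le_lt_trans lamj; rewrite le_eqVlt; apply/orP; left; apply/eqP.
  by field.
(* The j-th least squares coordinate lies within t / 2 of [t], hence is nonzero. *)
- have /(coord_sqnorm_le j) : sqnorm (betaLS X y - t *: delta_mx j 0) <= (t / 2) ^+ 2.
    by rewrite expr_div_n -natrX.
  have Et : (t *: delta_mx j 0 : 'cV[R]_p) j 0 = t by rewrite !mxE !eqxx mulr1.
  move=> /(_ t20); rewrite mxE [X in _ + X]mxE Et ler_distl => /andP[H _].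
  by rewrite gt_eqF//; lra.
Qed.

Theorem theorem1
  (R : realType) (d : measure_display) (T : measurableType d)
  (P : probability T R) (p : nat)
  (X : forall n : nat, 'M[R]_(n, p)) (C : 'M[R]_p)
  (lam : nat -> 'I_p -> R)
  (eps : nat -> T -> R) (sigma2 : R) :
  (* full column rank design for n >= p *)
  (forall n, (p <= n)%N -> \rank (X n) = p) ->
  (* X'X / n -> C, C positive definite *)
  (forall i j, (fun n : nat => (n%:R^-1 *: ((X n)^T *m X n)) i j) @ \oo --> (C i j : R)) ->
  C^T = C ->
  (forall v : 'cV[R]_p, v != 0 -> 0 < (v^T *m C *m v) 0 0) ->
  (* nonnegative tuning parameters *)
  (forall n j, 0 <= lam n j) ->
  (* errors: i.i.d. random variables, mean zero, finite variance sigma2 > 0 *)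
  (forall i, measurable_fun setT (eps i)) ->
  (forall (n : nat) (B : 'I_n -> set R), (forall i, measurable (B i)) ->
     P [set w | forall i : 'I_n, B i (eps (nat_of_ord i) w)]
     = (\prod_(i < n) P (eps (nat_of_ord i) @^-1` B i))%E) ->
  (forall i (B : set R), measurable B ->
     P (eps i @^-1` B) = P (eps 0%N @^-1` B)) ->
  P.-integrable setT (fun w => (eps 0%N w)%:E) ->
  (\int[P]_w (eps 0%N w)%:E = 0)%E ->
  0 < sigma2 ->
  (\int[P]_w ((eps 0%N w) ^+ 2)%:E = sigma2%:E)%E ->
  (* the events {betaLS_j = 0} have probability zero *)
  (forall n (beta : 'cV[R]_p) (j : 'I_p), (p <= n)%N ->
     P [set w | betaLS (X n) (resp (X n) beta eps w) j 0 = 0] = 0%E) ->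
  let ALest n beta w := betaAL (X n) (lam n) (resp (X n) beta eps w) in
  let cond_a := forall (beta : 'cV[R]_p) (e : R), 0 < e ->
      (fun n => P [set w | e < enorm (ALest n beta w - beta)]) @ \oo --> 0%E in
  let cond_b := forall e : R, 0 < e ->
      (fun n => ereal_sup
        [set P [set w | e < enorm (ALest n beta w - beta)] | beta in [set: 'cV[R]_p]])
      @ \oo --> 0%E in
  let cond_c := (fun n : nat => lam_star (lam n) / n%:R) @ \oo --> (0 : R) in
  let cond_d := forall (beta : 'cV[R]_p) (j : 'I_p), beta j 0 != 0 ->
      (fun n => P [set w | ALest n beta w j 0 = 0]) @ \oo --> 0%E in
  (cond_a <-> cond_b) /\ (cond_b <-> cond_c) /\ (cond_c <-> cond_d).
Proof.
move=> _ XC CT Cpos lam0 meps ind idd int0 mean0 sigma0 var _.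
move=> ALest cond_a cond_b cond_c cond_d.
have [c [K [c0 K0 gram]]] := gram_eventually XC CT Cpos.
have mAL : \forall n \near \oo, forall beta j,
    measurable_fun setT (fun w => ALest n beta w j 0).
  apply: filterS gram => n [n0 Xc XK] beta j.
  have m0 : 0 < n%:R * c by rewrite mulr_gt0// ltr0n.
  apply: measurable_betaAL (lam0 n) m0 Xc => i; exact: measurable_resp.
have mErr : \forall n \near \oo, forall beta e, 0 < e ->
    measurable [set w | e < enorm (ALest n beta w - beta)].
  apply: filterS mAL => n mn beta e e0; apply: measurable_gt_enorm => // j.
  under eq_fun do rewrite mxE.
  by apply: measurable_funD.
have m0AL : \forall n \near \oo, forall beta j,
    measurable [set w | ALest n beta w j 0 = 0].
  apply: filterS mAL => n mn beta j.
  have := mn beta j measurableT [set 0] (measurable_set1 0).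
  by rewrite setTI.
pose B := p%:R * K * sigma2 / c ^+ 2.
have dev : \forall n \near \oo, forall beta s, 0 < s ->
    measurable [set w | s < sqnorm (betaLS (X n) (resp (X n) beta eps w) - beta)] /\
    (P [set w | (s < sqnorm (betaLS (X n) (resp (X n) beta eps w) - beta))%R] <=
      (B / s / n%:R)%:E)%E.
  apply: filterS gram => n [n0 Xc XK] beta s s0; split; last first.
    apply: betaLS_deviation (ltW sigma0) c0 s0 n0 Xc XK => // a.
    exact: (weighted_sum_second_moment meps ind idd int0 mean0 var).
  apply: measurable_gt_sqnorm => i; under eq_fun do rewrite mxE.
  apply: measurable_funD => //; apply: measurable_betaLS => k.
  exact: measurable_resp.
have ba : cond_b -> cond_a.
  move=> b beta e e0; apply: cvge0_le => r r0.
  near=> n.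
  have mE : forall beta e, 0 < e ->
    measurable [set w | e < enorm (ALest n beta w - beta)] by near: n.
  rewrite measure_ge0 ?(mE beta e e0)//=.
  apply: (@le_trans _ _ (ereal_sup [set P [set w | e < enorm (ALest n beta w - beta)] |
    beta in [set: 'cV[R]_p]])); first by apply: ereal_sup_ubound; exists beta.
  by apply: ltW; near: n; exact: cvge0_lt (b e e0) r0.
have ad : cond_a -> cond_d.
  move=> a beta j bj; apply: cvge0_le => r r0.
  have e0 : 0 < `|beta j 0| / 2 by rewrite divr_gt0// normr_gt0.
  near=> n.
  have mE : forall beta e, 0 < e ->
    measurable [set w | e < enorm (ALest n beta w - beta)] by near: n.
  have mZ : forall beta j, measurable [set w | ALest n beta w j 0 = 0] by near: n.
  rewrite measure_ge0 ?mZ//=.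
  apply: (@le_trans _ _ (P [set w | `|beta j 0| / 2 < enorm (ALest n beta w - beta)])).
    apply: le_measure; rewrite ?inE; [exact: mZ|exact: mE|].
    (* A j-th coordinate estimated as 0 is an error of at least |beta_j|, above the threshold
       |beta_j| / 2. *)
    move=> w /= w0; rewrite ltNge enorm_le ?(ltW e0)//; apply/negP.
    move=> /(coord_sqnorm_le j (ltW e0)); rewrite !mxE w0 sub0r normrN; lra.
  by apply: ltW; near: n; exact: cvge0_lt (a beta _ e0) r0.
have cb : cond_c -> cond_b.
  move=> lam_cvg e e0; apply: cvge0_le => r r0.
  have e20 : 0 < e ^+ 2 by rewrite exprn_gt0.
  have e24 : 0 < e ^+ 2 / 4 by rewrite divr_gt0.
  (* Chosen so that lambda^*/n < [eta] yields the premise of [betaAL_error] at the squared threshold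
     [e ^+ 2]. *)
  pose eta := c * (e ^+ 2 / 8) / (2 * p.+1%:R).
  have eta0 : 0 < eta by rewrite divr_gt0// mulr_gt0// divr_gt0.
  near=> n.
  have [n0 Xc XK] : [/\ (0 < n)%N,
    forall v, n%:R * c * sqnorm v <= sqnorm (X n *m v) &
    forall i j, `|((X n)^T *m X n) i j| <= n%:R * K] by near: n.
  have nR : 0 < n%:R :> R by rewrite ltr0n.
  have m0 : 0 < n%:R * c by rewrite mulr_gt0.
  have mE : forall beta e, 0 < e ->
    measurable [set w | e < enorm (ALest n beta w - beta)] by near: n.
  have devn : forall beta s, 0 < s ->
    measurable [set w | s < sqnorm (betaLS (X n) (resp (X n) beta eps w) - beta)] /\
    (P [set w | (s < sqnorm (betaLS (X n) (resp (X n) beta eps w) - beta))%R] <=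
      (B / s / n%:R)%:E)%E by near: n.
  have Bn : B / (e ^+ 2 / 4) / n%:R <= r by near: n; exact: inv_nat_eventually_le.
  have lamn : 2 * p%:R * lam_star (lam n) <= n%:R * c * (e ^+ 2 / 8).
    have : `|lam_star (lam n) / n%:R| < eta.
      by near: n; apply: (cvgr_norm_lt _ lam_cvg); rewrite normr0.
    rewrite ger0_norm ?divr_ge0 ?lam_star_ge0// ltr_pdivrMr// => /ltW H.
    have -> : n%:R * c * (e ^+ 2 / 8) = 2 * p.+1%:R * (eta * n%:R).
      have : (p.+1%:R : R) != 0 by rewrite pnatr_eq0.
      by rewrite /eta; move: (p.+1%:R : R) => q q0; field.
    by rewrite ler_pM ?mulr_ge0 ?lam_star_ge0// ler_wpM2l// ler_nat.
  apply/andP; split.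
    (* The supremum is nonnegative because it dominates the term at parameter 0. *)
    apply: (@le_trans _ _ (P [set w | e < enorm (ALest n 0 w - 0)])).
      by rewrite measure_ge0 ?mE.
    by apply: ereal_sup_ubound; exists 0.
  apply: ge_ereal_sup => _ [beta _ <-].
  apply: (@le_trans _ _ (B / (e ^+ 2 / 4) / n%:R)%:E); last by rewrite lee_fin.
  have [mD] := devn beta _ e24; apply: le_trans.
  apply: le_measure; rewrite ?inE; [exact: mE|exact: mD|].
  move=> w /=; rewrite ltNge enorm_le ?(ltW e0)// -ltNge.
  exact: (betaAL_error (lam0 n) m0 Xc lamn).
have dc : cond_d -> cond_c.
  move=> dd; apply: lam_star_cvg0 => r j r0.
  (* The summand 1 gives [k <= k ^+ 2], hence [K * p%:R <= c * k ^+ 2]. *)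
  pose k := K * p%:R / c + 1.
  have k1 : 1 <= k by rewrite lerDr divr_ge0 ?(ltW c0)// mulr_ge0// ltW.
  have k0 : 0 <= k by exact: le_trans ler01 k1.
  have Kk : K * p%:R <= c * k ^+ 2.
    rewrite [leRHS]mulrC -ler_pdivrMr//.
    apply: (@le_trans _ _ k); first by rewrite lerDl.
    by rewrite expr2 ler_peMr.
  pose L := 4 * K * (p%:R * k + (1 + k) / 2).
  have L0 : 0 < L.
    rewrite mulr_gt0 ?mulr_gt0//; apply: ltr_wpDl; first exact: mulr_ge0.
    by rewrite divr_gt0// ltr_wpDr.
  (* This makes [L * t ^+ 2] equal to [r / 2], so [lam n j / n%:R >= r] meets the premise of
     [betaAL_selects_out] strictly. *)
  pose t := Num.sqrt (r / 2 / L).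
  have q0 : 0 < r / 2 / L by rewrite !divr_gt0.
  have t0 : 0 < t by rewrite sqrtr_gt0.
  have Lt : L * t ^+ 2 = r / 2.
    by rewrite sqr_sqrtr ?(ltW q0)// mulrC divfK// gt_eqF.
  pose beta : 'cV[R]_p := t *: delta_mx j 0.
  have bj : beta j 0 != 0 by rewrite !mxE !eqxx mulr1 gt_eqF.
  have s0 : 0 < t ^+ 2 / 4 by rewrite divr_gt0// exprn_gt0.
  near=> n.
  have [n0 Xc XK] : [/\ (0 < n)%N,
    forall v, n%:R * c * sqnorm v <= sqnorm (X n *m v) &
    forall i j, `|((X n)^T *m X n) i j| <= n%:R * K] by near: n.
  have nR : 0 < n%:R :> R by rewrite ltr0n.
  have m0 : 0 < n%:R * c by rewrite mulr_gt0.
  have mZ : forall beta j, measurable [set w | ALest n beta w j 0 = 0] by near: n.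
  have devn : forall beta s, 0 < s ->
    measurable [set w | s < sqnorm (betaLS (X n) (resp (X n) beta eps w) - beta)] /\
    (P [set w | (s < sqnorm (betaLS (X n) (resp (X n) beta eps w) - beta))%R] <=
      (B / s / n%:R)%:E)%E by near: n.
  have [mD PD] := devn beta _ s0.
  have Bn : B / (t ^+ 2 / 4) / n%:R <= 4^-1.
    by near: n; apply: inv_nat_eventually_le; rewrite invr_gt0.
  have PZ : (P [set w | (ALest n beta w j 0 = 0)%R] < (4^-1)%:E)%E.
    by near: n; apply: cvge0_lt (dd beta j bj) _; rewrite invr_gt0.
  rewrite ltNge; apply/negP => lamr.
  (* If [lam n j / n%:R >= r] at such an [n], every outcome has a large least squares error or a
     zero coordinate. These events have probabilities below 1/2 and 1/4, too little to cover the
     space. *)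
  have cover : setT = [set w | t ^+ 2 / 4 <
      sqnorm (betaLS (X n) (resp (X n) beta eps w) - beta)] `|`
      [set w | ALest n beta w j 0 = 0].
    apply/seteqP; split => // w _ /=.
    have [|small] := ltP (t ^+ 2 / 4) (sqnorm (betaLS (X n) (resp (X n) beta eps w) - beta)).
      by left.
    right; apply: (betaAL_selects_out (lam0 n) m0 Xc XK k0 Kk t0 _ small).
    rewrite -/L Lt; apply: (@lt_le_trans _ _ (n%:R * r)).
      by rewrite ltr_pM2l//; lra.
    by rewrite mulrC -ler_pdivlMr.
  have : (P setT < 1)%E.
    rewrite cover; apply: le_lt_trans (measureU2 P mD (mZ _ _)) _.
    have PD2 := le_trans PD (_ : _ <= (4^-1)%:E)%E.
    apply: (@lt_le_trans _ _ ((2^-1)%:E + (4^-1)%:E)%E).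
      apply: lteD => //; apply: le_lt_trans (PD2 _) _; rewrite ?lee_fin ?lte_fin//.
      by lra.
    by rewrite -EFinD lee_fin; lra.
  by rewrite probability_setT ltxx.
(* The equivalences follow from the cycle (b) => (a) => (d) => (c) => (b). *)
have Hab : cond_a <-> cond_b by split=> [/ad/dc/cb|/ba].
have Hbc : cond_b <-> cond_c by split=> [/ba/ad/dc|/cb].
by split=> //; split=> //; split=> [/cb/ba/ad|/dc].
Unshelve. all: by end_near.
Qed.
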